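(* Let $m$ be a nonnegative integer and let $a,b\in\mathbb{N}$ with $\gcd(a,b)=1$. Suppose $b=aq_0+r_0$, where $q_0$ and $r_0$ are nonnegative integers with $0<r_0<a$. Let $r$ be the integer with $0\le r<a$ and $r\equiv m \pmod a$; let $r_m$ be the integer with $0\le r_m<r_0$ and $r_m\equiv r \pmod{r_0}$; and let $k_m$ be the integer with $0\le k_m<r_0$ and $k_m\equiv -a_{r_0}^{-1}r_m \pmod{r_0}$, where $a_{r_0}^{-1}$ denotes the inverse of $a$ modulo $r_0$. Then $m$ can be expressed in the form $ax+by$ for some nonnegative integers $x$ and $y$ if and only if $$\left\lfloor \frac{m}{a}\right\rfloor \ \ge\ q_0\,\frac{m}{b}+k_m .$$
   Context: $\mathbb{N}$ denotes the positive integers. The quantity $q_0\frac{m}{b}$ is a rational number (ordinary division, no rounding). Since $\gcd(a,b)=1$ and $b=aq_0+r_0$, one has $\gcd(a,r_0)=1$, so the inverse of $a$ modulo $r_0$ exists (for $r_0=1$ everything is congruent to $0$ and $k_m=0$). *)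

(* Defs.v *)
From mathcomp Require Export all_boot all_order all_algebra.

Set Implicit Arguments.
Unset Strict Implicit.
Unset Printing Implicit Defensive.

Import GRing.Theory Num.Theory.

(* The condition determines [x] only modulo [n]. *)
Definition inverse_mod (n a x : int) : Prop := (a * x = 1 %[mod n])%Z.

(* Main.v *)
(* Write m = a n + r with n = floor (m / a).  Since r + a km = 0 mod r0, there is
   y0 with r + a km = r0 y0, and km < r0 gives 0 <= y0 < a.  As r0 y0 = r and
   b = r0 mod a, y0 is the least y >= 0 with b y = m mod a, so m is representable
   iff b y0 <= m, that is iff q0 y0 + km <= n.  Multiplying by r0 turns this into
   q0 r + b km <= r0 n, which is the inequality of the theorem multiplied by b. *)
Require Import Defs.
From mathcomp Require Import all_boot all_order all_algebra.
From mathcomp Require Import zify ring.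

Set Implicit Arguments.
Unset Strict Implicit.
Unset Printing Implicit Defensive.

Import GRing.Theory Num.Theory.

Local Open Scope ring_scope.

Lemma floor_divn_rat (m a : nat) :
  (0 < a)%N -> Num.floor (m%:R / a%:R : rat) = (m %/ a)%N%:Z.
Proof.
move=> a_gt0; apply: floor_def.
have a_gt0R : 0 < a%:R :> rat by rewrite ltr0n.
rewrite ler_pdivlMr // ltr_pdivrMr // -PoszD addn1 -!pmulrn -!natrM.
by rewrite ler_nat ltr_nat leq_divM ltn_ceil.
Qed.

(** Modulo [a], any solution satisfies [r0 * y = r = r0 * y0]; as [r0] is invertible there and
    [y0 < a], this forces [y0 <= y]. *)
Lemma representable_iff_least (n r a q r0 k y0 : nat) :
  (0 < a)%N -> coprime a r0 -> (0 < r0)%N -> (y0 < a)%N ->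
  (r + a * k = r0 * y0)%N ->
  (exists x y : nat, a * n + r = a * x + (a * q + r0) * y)%N <->
  (q * y0 + k <= n)%N.
Proof.
move=> a_gt0 co_ar0 r0_gt0 y0_lt_a def_y0; split=> [[x [y def_m]]|le_n]; last first.
  (* Since [r = r0 * y0 - a * k], removing [(a * q + r0) * y0] from [a * n + r] leaves
     [a * (n - q * y0 - k)]. *)
  by exists (n - (q * y0 + k))%N, y0; nia.
have le_y0y : (y0 <= y)%N.
  have [//|lt_yy0] := leqP y0 y.
  have dvd_a : (a %| r0 * (y0 - y))%N.
    rewrite mulnBr -def_y0; apply/dvdnP.
    (* The quotient comes from eliminating [r] between [def_m] and [def_y0]; it is positive because
       [y < y0], so the subtraction does not truncate. *)
    by exists (k + x + q * y - n)%N; nia.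
  rewrite Gauss_dvdr // in dvd_a.
  by have := dvdn_leq _ dvd_a; lia.
have le_m : ((a * q + r0) * y0 <= a * n + r)%N.
  by rewrite def_m (leq_trans (leq_mul (leqnn _) le_y0y)) // leq_addl.
by rewrite -(leq_pmul2l a_gt0); nia.
Qed.

Theorem theorem17 (m a b q0 r0 : nat) (r rm km ainv : int)
  (ha : (0 < a)%N) (hb : (0 < b)%N) (hab : coprime a b)
  (hbq : b = (a * q0 + r0)%N) (hr0 : (0 < r0 < a)%N)
  (hr : 0 <= r < a%:Z) (hr_cong : (r = m%:Z %[mod a%:Z])%Z)
  (hrm : 0 <= rm < r0%:Z) (hrm_cong : (rm = r %[mod r0%:Z])%Z)
  (hainv : inverse_mod r0%:Z a%:Z ainv)
  (hkm : 0 <= km < r0%:Z) (hkm_cong : (km = - ainv * rm %[mod r0%:Z])%Z) :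
  (exists x y : nat, m = (a * x + b * y)%N) <->
  ((Num.floor (m%:R / a%:R : rat))%:~R >= q0%:R * (m%:R / b%:R) + km%:~R :> rat).
Proof.
have [r0_gt0 r0_lt_a] := andP hr0.
have dvd_r0 : (r0%:Z %| r + a%:Z * km)%Z.
  move/eqP: hrm_cong; rewrite eqz_mod_dvd => /dvdzP[u def_u].
  move/eqP: hkm_cong; rewrite eqz_mod_dvd => /dvdzP[v def_v].
  move/eqP: hainv; rewrite eqz_mod_dvd => /dvdzP[w def_w].
  (* Substituting [r] and [km] gives [- u * r0 - (a * ainv - 1) * rm + a * v * r0], where
     [a * ainv - 1 = w * r0]. *)
  apply/dvdzP; exists (- u - w * rm + a%:Z * v).
  have -> : r = rm - u * r0%:Z by rewrite -def_u; ring.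
  have -> : km = - ainv * rm + v * r0%:Z by rewrite -def_v; ring.
  transitivity (- (u * r0%:Z) - (a%:Z * ainv - 1) * rm + a%:Z * (v * r0%:Z)).
    by ring.
  by rewrite def_w; ring.
have def_r : r = (m %% a)%N%:Z.
  by rewrite -modz_nat -hr_cong modz_small // ger0_norm.
case: km hkm hkm_cong dvd_r0 => // k hk _.
rewrite def_r -PoszM -PoszD dvdzE /= => /dvdnP[y0 def_y0].
have co_ar0 : coprime a r0 by move: hab; rewrite hbq /coprime mulnC gcdnMDl.
have r_lt_a : (m %% a < a)%N by rewrite ltn_mod.
have y0_lt_a : (y0 < a)%N.
  by rewrite -(ltn_pmul2r r0_gt0) -def_y0; nia.
rewrite (mulnC y0) in def_y0.
rewrite floor_divn_rat // -!pmulrn mulrA.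
have bR_gt0 : 0 < b%:R :> rat by rewrite ltr0n.
rewrite -lerBrDr ler_pdivrMr // mulrBl lerBrDr -!natrM -natrD ler_nat.
(* With [n = m %/ a], the term [a * q0 * n] occurs in both [q0 * m] and [n * b] and cancels. *)
have -> : (q0 * m + k * b <= m %/ a * b)%N = (q0 * y0 + k <= m %/ a)%N.
  rewrite -[RHS](leq_pmul2l r0_gt0) mulnDr [in RHS]mulnCA -def_y0 hbq.
  rewrite {1}(divn_eq m a).
  by apply/idP/idP; nia.
rewrite {1}(divn_eq m a) (mulnC _ a) hbq.
exact: representable_iff_least.
Qed.
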